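(* Let $\Omega\subset\mathbb{R}^2$ be measurable with $0<|\Omega|<\infty$. Then $$\sup_{f\in L^2(\mathbb{R})\setminus\{0\}}\frac{\|W_{\mathrm{BJ}}f\|_{L^\infty(\Omega)}}{\|f\|_{L^2}^2}=\pi,$$ but the supremum is not attained.
   Context: For $f\in L^2(\mathbb{R})$ and $\tau\in(0,1)$ the $\tau$-Wigner distribution is $$W_\tau f(z)=\int_{\mathbb{R}} e^{-2\pi i\,\xi y} f(x+\tau y)\overline{f(x-(1-\tau)y)}\,dy,\qquad z=(x,\xi)\in\mathbb{R}^2,$$ and the Born--Jordan distribution is $W_{\mathrm{BJ}}f(z)=\int_0^1 W_\tau f(z)\,d\tau$. $\|\cdot\|_{L^\infty(\Omega)}$ is the essential supremum norm over $\Omega$. *)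

(* Defs.v *)
From mathcomp Require Export all_boot all_order all_algebra.
From mathcomp Require Export all_classical all_reals all_analysis.
From mathcomp Require Export measurable_realfun ess_sup_inf.
From mathcomp.real_closed Require Export complex.

Set Implicit Arguments.
Unset Strict Implicit.
Unset Printing Implicit Defensive.

Export Order.TTheory GRing.Theory Num.Theory.
Export numFieldNormedType.Exports.

Local Open Scope classical_set_scope.
Local Open Scope ring_scope.

Section complex_functions.
Context {R : realType}.

Definition cexpi (t : R) : R[i] := (cos t +i* sin t)%C.

(* The library only integrates (extended) real-valued functions: a
   complex-valued function is integrated componentwise. *)
Definition cintegral {d} {T : measurableType d}
    (mu : {measure set T -> \bar R}) (D : set T) (F : T -> R[i]) : R[i] :=
  (Rintegral mu D (fun t => complex.Re (F t)) +i*
   Rintegral mu D (fun t => complex.Im (F t)))%C.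

(* L^p norm of a complex-valued function, i.e. of its modulus. *)
Definition cLnorm {d} {T : measurableType d}
    (mu : {measure set T -> \bar R}) (p : \bar R) (F : T -> R[i]) : \bar R :=
  Lnorm mu p (fun t => (Normc.normc (F t))%:E).

(* Elements of L^2(R) are represented by Borel functions; every class modulo
   a.e. equality contains one. *)
Definition L2 (f : R -> R[i]) : Prop :=
  [/\ measurable_fun setT (fun x => complex.Re (f x)),
      measurable_fun setT (fun x => complex.Im (f x)) &
      (cLnorm lebesgue_measure 2%:E f < +oo)%E].

Definition L2_nonzero : set (R -> R[i]) :=
  [set f | L2 f /\ ~ ae_eq lebesgue_measure setT f (cst 0)].

Definition wigner (tau : R) (f : R -> R[i]) (z : R * R) : R[i] :=
  cintegral lebesgue_measure setT (fun y =>
    cexpi (- (2 * pi * z.2 * y)) * f (z.1 + tau * y)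
      * conjc (f (z.1 - (1 - tau) * y))).

Definition born_jordan (f : R -> R[i]) (z : R * R) : R[i] :=
  cintegral lebesgue_measure `]0, 1[ (fun tau => wigner tau f z).

Definition lebesgue2 :
    {measure set (measurableTypeR R * measurableTypeR R) -> \bar R} :=
  (@lebesgue_measure R \x @lebesgue_measure R)%E.

(* [lebesgue2] lives on the Borel sigma-algebra; Lebesgue measurable sets are
   the Borel sets up to negligible sets, and their measure is given by the
   outer measure [mu_ext lebesgue2]. *)
Definition lebesgue2_measurable : set (set (R * R)) :=
  completed_algebra_gen lebesgue2.

Definition lebesgue2_vol (Omega : set (R * R)) : \bar R :=
  mu_ext lebesgue2 Omega.

(* Extending F by 0 outside Omega does not affect the
   essential supremum of |F| over Omega. *)
Definition Linfty_norm_on (Omega : set (R * R)) (F : R * R -> R[i]) : \bar R :=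
  cLnorm lebesgue2 +oo%E (patch (fun=> 0) Omega F).

Definition BJ_ratio (Omega : set (R * R)) (f : R -> R[i]) : \bar R :=
  (Linfty_norm_on Omega (born_jordan f)
    / (cLnorm lebesgue_measure 2%:E f) ^+ 2)%E.

End complex_functions.

(* Main.v *)
Require Import Defs.
From mathcomp Require Import ring lra.

(** Write $a=|f|$ and $M=\|f\|_{L^2}^2$.

    Upper bound. For fixed $\tau$ the two factors $f(x+\tau y)$ and
    $f(x-(1-\tau)y)$ are dilates of the same function. After multiplication by
    $\sqrt\tau$ and $\sqrt{1-\tau}$ they have the norm of $f$, whence
    $|W_\tau f(z)|\le(\tau(1-\tau))^{-1/2}M$ ([normc_wigner_le_density]), and
    $\int_0^1(\tau(1-\tau))^{-1/2}d\tau=\pi$ because $\arcsin(2\tau-1)$ is a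
    primitive ([integral_arcsine_density_le]).

    The bound is not attained. Pointwise strictness would not suffice, since an
    essential supremum over a possibly unbounded set has to be controlled; what
    is proved is a gap $c>0$, depending on $f$ only, with
    $|W_{BJ}f(z)|\le\pi M-c$ for all $z$ ([born_jordan_gap]). The gap comes from
    small $\tau$: one dilate is then spread out and the other one is not, so
    that their normalized pairing tends to 0 as $\tau\to0$. Truncating $a$ in
    both height and support shows that this happens uniformly in the centre $x$
    ([corr_small_dilation]), and taking absolute values removes the frequency.

    The bound is sharp. Equality in Cauchy-Schwarz for all $\tau$ would force
    $a(t)=C|t|^{-1/2}$, which is not square integrable at 0 or at infinity. The
    function $(1+|t|)^{-1/2}$ cut off at $|t|<B$ has $M=2\ln(1+B)$, and for
    $\tau$ in a compact part of $]0,1[$ its pairing is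
    $(\tau(1-\tau))^{-1/2}(2\ln B+O(1))$, even when the centre is moved by at
    most 1 ([sqrt_hyperbola_pair_ge], [integral_hyperbola]). Its Born-Jordan
    distribution is therefore close to $\pi M$ on a whole box around the origin
    of phase space, whose height in frequency depends on $B$. Some translate of
    that box meets $\Omega$ in a set of positive measure
    ([lebesgue2_vol_box]), and translating and modulating the function moves the
    box there. *)

Set Implicit Arguments.
Unset Strict Implicit.
Unset Printing Implicit Defensive.

Local Open Scope classical_set_scope.
Local Open Scope ring_scope.

(** * Affine changes of variables and normalized pairings *)

Section affine.
Context {R : realType}.
Notation mu := (@lebesgue_measure R).

Lemma measurable_sqrt : measurable_fun setT (@Num.sqrt R).
Proof. by apply: continuous_measurable_fun; exact: sqrt_continuous. Qed.

Lemma measurable_affine (x c : R) :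
  measurable_fun setT (fun y : R => x + c * y).
Proof. by apply: measurable_funD => //; exact: measurable_funM. Qed.

Let ge0_integral_affine_pos (x c : R) (g : R -> \bar R) : 0 < c ->
  measurable_fun setT g -> (forall y, 0 <= g y)%E ->
  (\int[mu]_y g y = c%:E * \int[mu]_y g (x + c * y)%R)%E.
Proof.
move=> c0 mg g0.
pose phi : measurableTypeR R -> measurableTypeR R := fun y => x + c * y.
have mphi : measurable_fun setT phi by exact: measurable_affine.
pose nu := mscale (NngNum (ltW c0))
  (measure_function_pushforward__canonical__measure_function_Measure mu mphi).
transitivity (\int[nu]_y g y)%E; last first.
  rewrite ge0_integral_mscale//=; congr (_ * _)%E.
  by rewrite ge0_integral_pushforward.
apply: eq_measure_integral => A mA _.
apply: lebesgue_measure_unique => // _ [[a b]] _ <-.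
rewrite [RHS](_ : _ = c%:E * mu (phi @^-1` `]a, b]))%E//.
have -> : phi @^-1` `]a, b] = `](a - x) / c, (b - x) / c]%classic.
  apply/seteqP; split => y; rewrite /= !in_itv/= ltr_pdivrMr// ler_pdivlMr//;
    rewrite /phi; (move=> /andP[? ?]; apply/andP; split; lra).
rewrite !lebesgue_measure_itv/= !lte_fin.
rewrite ltr_pM2r ?invr_gt0// ltrD2r; case: ifPn => _; last by rewrite mule0.
rewrite -EFinM; congr EFin; field; lra.
Qed.

(** Lebesgue measure and its rescaled push-forward under an increasing affine
    map agree on intervals, hence everywhere; negative slopes reduce to positive
    ones by reflection. *)
Lemma ge0_integral_affine (x c : R) (g : R -> \bar R) : c != 0 ->
  measurable_fun setT g -> (forall y, 0 <= g y)%E ->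
  (\int[mu]_y g y = `|c|%:E * \int[mu]_y g (x + c * y)%R)%E.
Proof.
move=> c0 mg g0; case: (ltgtP c 0) c0 => // [c_lt0|c_gt0] _; last first.
  by rewrite gtr0_norm//; exact: ge0_integral_affine_pos.
rewrite ltr0_norm//.
have -> : (\int[mu]_y g y = \int[mu]_y g (- y)%R)%E.
  have mN : measurable_fun setT (-%R : measurableTypeR R -> measurableTypeR R).
    exact: oppr_measurable.
  rewrite -(@ge0_integral_pushforward _ _ _ _ R _ mN mu setT g)//.
  by apply: eq_measure_integral => A mA _; exact/esym/lebesgue_measureN.
rewrite (@ge0_integral_affine_pos (- x) (- c) (fun y => g (- y)%R)) ?oppr_gt0//.
  congr (_ * _)%E; apply: eq_integral => y _; congr g; ring.
by apply: (measurableT_comp mg); exact: oppr_measurable.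
Qed.

(** The factors $\sqrt{|c|}$ and $\sqrt{|d|}$ make both dilations unitary on
    $L^2$, so that no bound on this pairing has to mention the slopes. *)
Definition corr (a b : R -> R) (x c x' d : R) : \bar R :=
  (\int[mu]_y (Num.sqrt `|c| * a (x + c * y)%R *
    (Num.sqrt `|d| * b (x' + d * y)%R))%:E)%E.

Lemma measurable_affine_comp (a : R -> R) (x c : R) :
  measurable_fun setT a -> measurable_fun setT (fun y => a (x + c * y)).
Proof.
by move=> ma; apply: (measurableT_comp ma); exact: measurable_affine.
Qed.

Definition sqint (a : R -> R) : \bar R := (\int[mu]_y (a y ^+ 2)%:E)%E.

Lemma sqint_dilation (a : R -> R) (x c : R) : c != 0 -> measurable_fun setT a ->
  sqint (fun y => Num.sqrt `|c| * a (x + c * y)%R) = sqint a.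
Proof.
move=> c0 ma; rewrite [RHS](@ge0_integral_affine x c)//; last 2 first.
- by apply/measurable_EFinP; exact: measurable_funX.
- by move=> y; rewrite lee_fin sqr_ge0.
rewrite -ge0_integralZl//; last 2 first.
- apply/measurable_EFinP; apply: measurable_funX.
  exact: measurable_affine_comp.
- by move=> y _; rewrite lee_fin sqr_ge0.
by apply: eq_integral => y _; rewrite -EFinM exprMn sqr_sqrtr.
Qed.

(** Weighted form of the inequality between the arithmetic and the geometric
    mean. The free weight [l] lets a small factor compensate a large one. *)
Lemma corr_le (a b : R -> R) (x c x' d l : R) : c != 0 -> d != 0 -> 0 < l ->
  measurable_fun setT a -> measurable_fun setT b ->
  (forall t, 0 <= a t) -> (forall t, 0 <= b t) ->
  (corr a b x c x' d <=
    (l / 2)%:E * sqint a + (l^-1 / 2)%:E * sqint b)%E.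
Proof.
move=> c0 d0 l0 ma mb a0 b0.
have mD (h : R -> R) (u v : R) : measurable_fun setT h ->
    measurable_fun setT (fun y => Num.sqrt `|v| * h (u + v * y)%R).
  by move=> mh; apply: measurable_funM => //; exact: measurable_affine_comp.
rewrite -(sqint_dilation x c0 ma) -(sqint_dilation x' d0 mb) /sqint.
rewrite -!ge0_integralZl//; last 6 first.
- by apply/measurable_EFinP; apply: measurable_funX; exact: mD.
- by move=> y _; rewrite lee_fin sqr_ge0.
- by rewrite lee_fin divr_ge0 ?invr_ge0// ltW.
- by apply/measurable_EFinP; apply: measurable_funX; exact: mD.
- by move=> y _; rewrite lee_fin sqr_ge0.
- by rewrite lee_fin divr_ge0// ltW.
have mZ (k : R) (h : R -> R) : measurable_fun setT h ->
    measurable_fun setT (fun y => (k%:E * (h y ^+ 2)%:E)%E).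
  move=> mh; under eq_fun do rewrite -EFinM.
  apply/measurable_EFinP; apply: measurable_funM => //.
  exact: measurable_funX.
rewrite -ge0_integralD//; last 4 first.
- by move=> y _; rewrite -EFinM lee_fin mulr_ge0 ?sqr_ge0// divr_ge0// ltW.
- by apply: mZ; exact: mD.
- move=> y _; rewrite -EFinM lee_fin mulr_ge0 ?sqr_ge0//.
  by rewrite divr_ge0 ?invr_ge0// ltW.
- by apply: mZ; exact: mD.
apply: ge0_le_integral => //.
- by move=> y _; rewrite lee_fin !mulr_ge0 ?sqrtr_ge0.
- by apply/measurable_EFinP/measurable_funM; exact: mD.
- by apply: emeasurable_funD; apply: mZ; exact: mD.
move=> y _; rewrite -!EFinM -EFinD lee_fin.
set u := Num.sqrt _ * _; set v := Num.sqrt _ * _.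
rewrite -subr_ge0.
have -> : l / 2 * u ^+ 2 + l^-1 / 2 * v ^+ 2 - u * v =
    (l * u - v) ^+ 2 / (2 * l) by field; lra.
by rewrite divr_ge0 ?sqr_ge0// mulr_ge0// ltW.
Qed.

End affine.

(** * Decorrelation under small dilations *)

Section decorrelation.
Context {R : realType}.
Notation mu := (@lebesgue_measure R).
Implicit Types (a b : R -> R).

Lemma measurable_dilation a (x c : R) : measurable_fun setT a ->
  measurable_fun setT (fun y => Num.sqrt `|c| * a (x + c * y)%R).
Proof.
by move=> ma; apply: measurable_funM => //; exact: measurable_affine_comp.
Qed.

Lemma measurable_corr_integrand a b (x c x' d : R) :
  measurable_fun setT a -> measurable_fun setT b ->
  measurable_fun setT (fun y => Num.sqrt `|c| * a (x + c * y)%R *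
    (Num.sqrt `|d| * b (x' + d * y)%R)).
Proof. by move=> ma mb; apply: measurable_funM; exact: measurable_dilation. Qed.

(** Cutting off both the variable and the value at level [k] leaves a core that
    is bounded with bounded support, whatever square integrable function one
    starts from. *)
Definition trunc_core a (k t : R) : R :=
  if (`|t| <= k) && (a t <= k) then a t else 0.

Definition trunc_tail a (k t : R) : R :=
  if (`|t| <= k) && (a t <= k) then 0 else a t.

Lemma measurable_trunc_cond a (k : R) : measurable_fun setT a ->
  measurable_fun setT (fun t : R => (`|t| <= k) && (a t <= k)).
Proof.
move=> ma; apply: measurable_and; exact: measurable_fun_ler.
Qed.

Lemma measurable_trunc_tail a (k : R) : measurable_fun setT a ->
  measurable_fun setT (trunc_tail a k).
Proof.
by move=> ma; apply: measurable_fun_ifT => //; exact: measurable_trunc_cond.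
Qed.

Lemma measurable_trunc_core a (k : R) : measurable_fun setT a ->
  measurable_fun setT (trunc_core a k).
Proof.
by move=> ma; apply: measurable_fun_ifT => //; exact: measurable_trunc_cond.
Qed.

(** Dominated convergence: every point eventually enters the core. *)
Lemma sqint_trunc_tail a (M e : R) : measurable_fun setT a ->
  (forall t, 0 <= a t) -> sqint a = M%:E -> 0 < e ->
  exists2 k : R, 0 < k & (sqint (trunc_tail a k) <= e%:E)%E.
Proof.
move=> ma a0 aM e0.
pose F n t := ((trunc_tail a n%:R t) ^+ 2)%:E.
have mF n : measurable_fun setT (F n).
  apply/measurable_EFinP; apply: measurable_funX.
  exact: measurable_trunc_tail.
have m2 : measurable_fun setT (fun t => (a t ^+ 2)%:E).
  by apply/measurable_EFinP; exact: measurable_funX.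
have := @dominated_convergence _ _ R mu setT measurableT F (cst 0%E)
  (fun t => (a t ^+ 2)%:E) mF (measurable_cst _).
have Fcvg : {ae mu, forall t, setT t -> F ^~ t @ \oo --> cst 0%E t}.
  apply: nearW => t _ /=; apply: cvg_near_cst; near=> n.
  rewrite /F /trunc_tail ifT ?expr0n//.
  apply/andP; split; near: n; exact: nbhs_infty_ger.
have iA : mu.-integrable setT (fun t => (a t ^+ 2)%:E).
  apply/integrableP; split => //.
  under eq_integral do rewrite gee0_abs ?lee_fin ?sqr_ge0//.
  by rewrite -/(sqint a) aM ltry.
have dom : {ae mu, forall t n, setT t -> (`|F n t| <= (a t ^+ 2)%:E)%E}.
  apply: nearW => t n _; rewrite gee0_abs ?lee_fin ?sqr_ge0//.
  by rewrite /trunc_tail; case: ifP => // _; rewrite expr0n sqr_ge0.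
move=> /(_ Fcvg iA dom)[_ _]; rewrite integral0 => F0.
have /fine_cvgP[Ffin Fcvg0] := F0.
near \oo => n; exists n%:R.
  by rewrite ltr0n; near: n; exact: nbhs_infty_gt.
rewrite /sqint -[leLHS]fineK; last by near: n.
by rewrite lee_fin ltW//; near: n; apply: (cvgr_lt _ Fcvg0).
Unshelve. all: by end_near. Qed.

(** The product of the two cores is at most $k^2$ and vanishes off an interval
    of length $2k/|d|$. *)
Lemma corr_trunc_core_le a (k x c x' d : R) : measurable_fun setT a ->
  (forall t, 0 <= a t) -> 0 < k -> d != 0 ->
  (corr (trunc_core a k) (trunc_core a k) x c x' d <=
   (Num.sqrt `|c| * Num.sqrt `|d| / `|d| * (2 * k ^+ 3))%:E)%E.
Proof.
move=> ma a0 k0 d0.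
have core0 t : 0 <= trunc_core a k t by rewrite /trunc_core; case: ifP.
pose h (t : R) : \bar R := (\1_`[-k, k]%classic t)%:E.
have mh : measurable_fun setT h.
  by apply/measurable_EFinP; exact: measurable_indic.
pose C := Num.sqrt `|c| * Num.sqrt `|d| * k ^+ 2.
have C0 : 0 <= C by rewrite !mulr_ge0 ?sqrtr_ge0// ltW.
apply: (@le_trans _ _ (\int[mu]_y (C%:E * h (x' + d * y)%R)))%E.
  apply: ge0_le_integral => //.
  - by move=> y _; rewrite lee_fin !mulr_ge0 ?sqrtr_ge0.
  - apply/measurable_EFinP; apply: measurable_corr_integrand;
      exact: measurable_trunc_core.
  - apply: measurable_funeM; apply: (measurableT_comp mh).
    exact: measurable_affine.
  move=> y _; rewrite /h -EFinM lee_fin indicE mem_setE in_itv/= -ler_norml.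
  have corek t : trunc_core a k t <= k.
    by rewrite /trunc_core; case: ifP => [/andP[]|_]//; exact: ltW.
  rewrite mulrACA; apply: (@le_trans _ _ (Num.sqrt `|c| * Num.sqrt `|d| *
      (k * (k * (`|x' + d * y| <= k)%R%:R)))); last by rewrite /C expr2 !mulrA.
  rewrite ler_wpM2l ?mulr_ge0 ?sqrtr_ge0//; apply: ler_pM => //.
  by rewrite /trunc_core; case: (`|x' + d * y| <= k) => //=;
    [case: ifP; rewrite mulr1// => _; exact: ltW|rewrite mulr0].
rewrite ge0_integralZl//; last 2 first.
- by apply: (measurableT_comp mh); exact: measurable_affine.
- by move=> y _; rewrite lee_fin.
have : (\int[mu]_y h y = (2 * k)%:E)%E.
  rewrite integral_indic// setIT/= lebesgue_measure_itv/= lte_fin ifT; last first.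
    by rewrite gtrN.
  by rewrite -EFinB; congr EFin; ring.
rewrite (@ge0_integral_affine _ x' d)//; last by move=> y; rewrite lee_fin.
set I := (\int[mu]_y _)%E => dI.
have d0' : 0 < `|d| by rewrite normr_gt0.
have -> : I = (2 * k / `|d|)%:E.
  rewrite mulrC EFinM -dI muleA -EFinM mulVf ?mul1e//; exact: lt0r_neq0.
by rewrite -EFinM lee_fin /C le_eqVlt; apply/orP; left; apply/eqP; ring.
Qed.

(** Decorrelation. A dilate with slope [c] close to 0 spreads its mass over a
    length of order $1/c$, while the other factor stays concentrated; the
    uniformity in the centres [x] and [x'] is what later excludes an extremizing
    sequence of points escaping to infinity. The pairing of the cores is
    $O(\sqrt c)$; the tails have small $L^2$ norm and are absorbed by [corr_le],
    with the weights 8 and 1/8 favouring the small factor. *)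
Lemma corr_small_dilation a (M : R) : measurable_fun setT a ->
  (forall t, 0 <= a t) -> sqint a = M%:E -> 0 < M ->
  exists2 t0 : R, 0 < t0 < 2^-1 & forall c d x x' : R,
    0 < c -> c < t0 -> 2^-1 <= `|d| <= 1 -> (corr a a x c x' d <= (M / 2)%:E)%E.
Proof.
move=> ma a0 aM M0.
(* The level M/64 is small enough for each of the two terms containing a tail
   to be at most M/8. *)
have [k k0 tailk] := sqint_trunc_tail ma a0 aM (divr_gt0 M0 (ltr0n _ 64)).
pose r := M / (16 * k ^+ 3).
have r0 : 0 < r by rewrite divr_gt0// mulr_gt0// exprn_gt0.
exists (Num.min (4^-1) (r ^+ 2)).
  rewrite lt_min exprn_gt0// invr_gt0 ltr0n/=.
  by rewrite (@le_lt_trans _ _ 4^-1)// ?ge_min ?lexx// ltf_pV2 ?posrE// ltr_nat.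
move=> c d x x' c0; rewrite lt_min => /andP[_ cr] /andP[d12 d1].
have d0 : d != 0 by rewrite -normr_gt0 (lt_le_trans _ d12).
have c0' : c != 0 by rewrite gt_eqF.
set a1 := trunc_core a k; set a2 := trunc_tail a k.
have m1 : measurable_fun setT a1 by exact: measurable_trunc_core.
have m2 : measurable_fun setT a2 by exact: measurable_trunc_tail.
have a10 t : 0 <= a1 t by rewrite /a1 /trunc_core; case: ifP.
have a20 t : 0 <= a2 t by rewrite /a2 /trunc_tail; case: ifP.
have a12 t : a t = a1 t + a2 t.
  by rewrite /a1 /a2 /trunc_core /trunc_tail; case: ifP; rewrite ?addr0 ?add0r.
(* Here a a' <= a1 a1' + a a2' + a2 a', the excess being a2 a2'. *)
have split3 : (corr a a x c x' d <=
    corr a1 a1 x c x' d + (corr a a2 x c x' d + corr a2 a x c x' d))%E.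
  rewrite /corr -!ge0_integralD//=; do ?[
    by move=> y _; rewrite lee_fin !mulr_ge0 ?sqrtr_ge0 |
    by apply/measurable_EFinP; exact: measurable_corr_integrand |
    by move=> y _; rewrite adde_ge0// lee_fin !mulr_ge0 ?sqrtr_ge0 |
    by apply: emeasurable_funD;
      apply/measurable_EFinP; exact: measurable_corr_integrand].
  apply: ge0_le_integral => //.
  - by move=> y _; rewrite lee_fin !mulr_ge0 ?sqrtr_ge0.
  - by apply/measurable_EFinP; exact: measurable_corr_integrand.
  - by do 2?apply: emeasurable_funD;
      apply/measurable_EFinP; exact: measurable_corr_integrand.
  move=> y _; rewrite -!EFinD lee_fin.
  set u := x + c * y; set v := x' + d * y; rewrite (a12 u) (a12 v) -subr_ge0.
  set p := Num.sqrt `|c|; set q := Num.sqrt `|d|.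
  rewrite [leRHS](_ : _ = p * q * (a2 u * a2 v)); last by ring.
  by rewrite !mulr_ge0 ?sqrtr_ge0.
have a2M : (sqint a2 <= (M / 64)%:E)%E := tailk.
apply: (le_trans split3).
have -> : (M / 2)%:E = ((M / 4)%:E + ((M / 8)%:E + (M / 8)%:E))%E.
  by rewrite -!EFinD; congr EFin; field.
apply: leeD; last apply: leeD.
- apply: (le_trans (corr_trunc_core_le _ _ _ _ _ _ _)) => //; rewrite lee_fin.
  have sc : Num.sqrt `|c| <= r.
    rewrite gtr0_norm// [leRHS](_ : _ = Num.sqrt (r ^+ 2)).
      by rewrite ler_wsqrtr// ltW.
    by rewrite sqrtr_sqr gtr0_norm.
  have sd : Num.sqrt `|d| / `|d| <= 2.
    rewrite ler_pdivrMr ?normr_gt0//; apply: (@le_trans _ _ 1); last by lra.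
    by rewrite -[leRHS]sqrtr1 ler_wsqrtr.
  apply: (@le_trans _ _ (r * 2 * (2 * k ^+ 3))).
    rewrite ler_wpM2r//; first by rewrite mulr_ge0// exprn_ge0// ltW.
    by rewrite -mulrA ler_pM ?sqrtr_ge0// divr_ge0 ?sqrtr_ge0.
  rewrite /r le_eqVlt; apply/orP; left; apply/eqP; field.
  by rewrite gt_eqF// exprn_gt0.
- apply: (@le_trans _ _ ((8^-1 / 2)%:E * M%:E +
      ((8^-1)^-1 / 2)%:E * (M / 64)%:E)%E).
    apply: (le_trans (@corr_le _ a a2 x c x' d (8^-1) _ _ _ _ _ _ _)) => //.
    by rewrite aM leeD2l// lee_wpmul2l// lee_fin.
  by rewrite -!EFinM -EFinD lee_fin; lra.
- apply: (@le_trans _ _ ((8 / 2)%:E * (M / 64)%:E + (8^-1 / 2)%:E * M%:E)%E).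
    apply: (le_trans (@corr_le _ a2 a x c x' d 8 _ _ _ _ _ _ _)) => //.
    by rewrite aM leeD2r// lee_wpmul2l// lee_fin.
  by rewrite -!EFinM -EFinD lee_fin; lra.
Qed.

End decorrelation.

(** * Integrals of complex-valued functions *)

Section cmeasurable.
Context {R : realType}.
Notation mu := (@lebesgue_measure R).

Definition cmeasurable d (T : measurableType d) (F : T -> R[i]) : Prop :=
  measurable_fun setT (fun t => complex.Re (F t)) /\
  measurable_fun setT (fun t => complex.Im (F t)).

Lemma cReM (w v : R[i]) : complex.Re (w * v) =
  complex.Re w * complex.Re v - complex.Im w * complex.Im v.
Proof. by case: w v => [? ?] [? ?]. Qed.

Lemma cImM (w v : R[i]) : complex.Im (w * v) =
  complex.Re w * complex.Im v + complex.Im w * complex.Re v.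
Proof. by case: w v => [? ?] [? ?]. Qed.

Lemma cRe_conj (w : R[i]) : complex.Re (conjc w) = complex.Re w.
Proof. by case: w. Qed.

Lemma cIm_conj (w : R[i]) : complex.Im (conjc w) = - complex.Im w.
Proof. by case: w. Qed.

Lemma cmeasurableM d (T : measurableType d) (F G : T -> R[i]) :
  cmeasurable F -> cmeasurable G -> cmeasurable (fun t => F t * G t).
Proof.
move=> [rF iF] [rG iG]; split.
  under eq_fun do rewrite cReM.
  by apply: measurable_funB; exact: measurable_funM.
under eq_fun do rewrite cImM.
by apply: measurable_funD; exact: measurable_funM.
Qed.

Lemma cmeasurable_conj d (T : measurableType d) (F : T -> R[i]) :
  cmeasurable F -> cmeasurable (fun t => conjc (F t)).
Proof.
move=> [rF iF]; split; first by under eq_fun do rewrite cRe_conj.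
under eq_fun do rewrite cIm_conj.
exact: measurableT_comp.
Qed.

Lemma cmeasurable_comp d (T : measurableType d) (f : R -> R[i]) (h : T -> R) :
  cmeasurable f -> measurable_fun setT h -> cmeasurable (fun t => f (h t)).
Proof.
by move=> [rf jf] mh; split; [exact: (measurableT_comp rf)|
  exact: (measurableT_comp jf)].
Qed.

Lemma cmeasurable_cexpi : cmeasurable (@cexpi R).
Proof.
by split => /=; apply: continuous_measurable_fun;
  [exact: continuous_cos|exact: continuous_sin].
Qed.

Lemma measurable_normc d (T : measurableType d) (F : T -> R[i]) :
  cmeasurable F -> measurable_fun setT (fun t => Normc.normc (F t)).
Proof.
move=> [rF iF].
have -> : (fun t => Normc.normc (F t)) = (fun t =>
    Num.sqrt (complex.Re (F t) ^+ 2 + complex.Im (F t) ^+ 2)).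
  by apply/funext => t; rewrite /Normc.normc; case: (F t).
apply: (measurableT_comp measurable_sqrt).
by apply: measurable_funD; exact: measurable_funX.
Qed.

Lemma normc_ge0 (w : R[i]) : 0 <= Normc.normc w.
Proof. by case: w => u v; exact: sqrtr_ge0. Qed.

Lemma normc_Re (w : R[i]) : `|complex.Re w| <= Normc.normc w.
Proof.
case: w => u v /=; rewrite -sqrtr_sqr ler_wsqrtr// lerDl; exact: sqr_ge0.
Qed.

Lemma normc_Im (w : R[i]) : `|complex.Im w| <= Normc.normc w.
Proof.
case: w => u v /=; rewrite -sqrtr_sqr ler_wsqrtr// lerDr; exact: sqr_ge0.
Qed.

Lemma normc_conj (w : R[i]) : Normc.normc (conjc w) = Normc.normc w.
Proof. by case: w => u v /=; rewrite sqrrN. Qed.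

Lemma normc_cexpi (t : R) : Normc.normc (cexpi t) = 1.
Proof. by rewrite /cexpi /= cos2Dsin2 sqrtr1. Qed.

Lemma normc_sqr (w : R[i]) :
  Normc.normc w ^+ 2 = complex.Re w ^+ 2 + complex.Im w ^+ 2.
Proof. by case: w => u v /=; rewrite sqr_sqrtr// addr_ge0// sqr_ge0. Qed.

Lemma dot_le_normc (w v : R[i]) :
  complex.Re w * complex.Re v + complex.Im w * complex.Im v <=
  Normc.normc w * Normc.normc v.
Proof.
have := normc_Re (conjc w * v); rewrite Normc.normcM normc_conj.
by apply: le_trans; rewrite cReM cRe_conj cIm_conj mulNr opprK ler_norm.
Qed.

Section integral.
Context d (T : measurableType d) (nu : {measure set T -> \bar R}) (D : set T).
Hypothesis mD : measurable D.

Lemma cintegrable (F : T -> R[i]) : cmeasurable F ->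
  (\int[nu]_(t in D) (Normc.normc (F t))%:E < +oo)%E ->
  nu.-integrable D (fun t => (complex.Re (F t))%:E) /\
  nu.-integrable D (fun t => (complex.Im (F t))%:E).
Proof.
move=> mF Foo.
have iF : nu.-integrable D (fun t => (Normc.normc (F t))%:E).
  apply/integrableP; split.
    by apply/measurable_EFinP/measurable_funTS; exact: measurable_normc.
  by under eq_integral do rewrite gee0_abs ?lee_fin ?normc_ge0//.
have [rF jF] := mF.
split; apply: (le_integrable mD _ _ iF).
- exact/measurable_EFinP/measurable_funTS.
- by move=> t _; rewrite lee_fin (ger0_norm (normc_ge0 _)) normc_Re.
- exact/measurable_EFinP/measurable_funTS.
- by move=> t _; rewrite lee_fin (ger0_norm (normc_ge0 _)) normc_Im.
Qed.

(** Rotating the integral onto the real axis reduces the triangle inequality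
    to the monotonicity of the real integral. *)
Lemma normc_cintegral_le (F : T -> R[i]) : cmeasurable F ->
  ((Normc.normc (cintegral nu D F))%:E <=
   \int[nu]_(t in D) (Normc.normc (F t))%:E)%E.
Proof.
move=> mF; set I := (\int[nu]_(t in D) _)%E.
have [Ioo|] := ltP I +oo%E; last by rewrite leye_eq => /eqP ->; rewrite leey.
have [iR iI] := cintegrable mF Ioo.
have mN : measurable_fun D (fun t => (Normc.normc (F t))%:E).
  by apply/measurable_EFinP/measurable_funTS; exact: measurable_normc.
have iN : nu.-integrable D (fun t => (Normc.normc (F t))%:E).
  apply/integrableP; split => //.
  by under eq_integral do rewrite gee0_abs ?lee_fin ?normc_ge0//.
set W := cintegral nu D F; set A := complex.Re W; set B := complex.Im W.
have [->|N0] := eqVneq (Normc.normc W) 0.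
  by apply: integral_ge0 => t _; rewrite lee_fin normc_ge0.
have Npos : 0 < Normc.normc W by rewrite lt0r N0 normc_ge0.
rewrite -(@lee_pmul2l _ (Normc.normc W)%:E)//.
rewrite -EFinM -expr2 normc_sqr -/A -/B.
have finA : (A%:E = \int[nu]_(t in D) (complex.Re (F t))%:E)%E.
  by rewrite /A /= /Rintegral fineK//; exact: integrable_fin_num.
have finB : (B%:E = \int[nu]_(t in D) (complex.Im (F t))%:E)%E.
  by rewrite /B /= /Rintegral fineK//; exact: integrable_fin_num.
rewrite EFinD !expr2 !EFinM [in X in (_ * X + _)%E]finA.
rewrite [in X in (_ + _ * X)%E]finB -!integralZl//.
rewrite -integralD//; [|exact: integrableZl..].
apply: le_integral => //.
- by apply: integrableD => //; exact: integrableZl.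
- exact: integrableZl.
by move=> t _; rewrite -!EFinM -EFinD lee_fin; exact: dot_le_normc.
Qed.

End integral.

(** Tonelli's theorem for the positive and negative parts. *)
Lemma measurable_Rintegral_section (F : R * R -> R) :
  measurable_fun (setT : set (measurableTypeR R * measurableTypeR R)) F ->
  measurable_fun setT (fun s : R => Rintegral mu setT (fun y => F (s, y))).
Proof.
move=> mF.
have mEF : measurable_fun (setT : set (measurableTypeR R * measurableTypeR R))
  (EFin \o F) by exact/measurable_EFinP.
have mP : measurable_fun setT (fubini_F mu (EFin \o F)^\+%E).
  apply: measurable_fun_fubini_tonelli_F => //.
  exact: measurable_funepos.
have mN : measurable_fun setT (fubini_F mu (EFin \o F)^\-%E).
  apply: measurable_fun_fubini_tonelli_F => //.
  exact: measurable_funeneg.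
have mI : measurable_fun setT
    (fun s : R => (\int[mu]_y (EFin \o F) (s, y))%E).
  rewrite (_ : (fun _ => _) =
      (fubini_F mu (EFin \o F)^\+ \- fubini_F mu (EFin \o F)^\-)%E).
    exact: emeasurable_funB mP mN.
  apply/funext => s; rewrite integralE /fubini_F.
  by congr (_ - _)%E; apply: eq_integral => y _; rewrite ?funeposE ?funenegE.
exact: (measurableT_comp (@fine_measurable R setT measurableT) mI).
Qed.

End cmeasurable.

(** * The arcsine density *)

Section arcsine.
Context {R : realType}.
Notation mu := (@lebesgue_measure R).

Lemma integral_is_derive (f F : R -> R) (a b : R) : a < b ->
  (forall x, a <= x <= b -> is_derive x 1 F (f x)) ->
  (forall x, a <= x <= b -> {for x, continuous f}) ->
  (\int[mu]_(x in `[a, b]) (f x)%:E = (F b - F a)%:E)%E.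
Proof.
move=> ab dF cf.
have cF x : a <= x <= b -> {for x, continuous F}.
  move=> /dF [dFx _]; apply: differentiable_continuous.
  exact/derivable1_diffP.
rewrite (@continuous_FTC2 _ f F)//.
- apply: continuous_in_subspaceT => x; rewrite inE/= in_itv/=; exact: cf.
- split.
  + by move=> x; rewrite in_itv/= => /andP[ax xb]; 
    have [] // : is_derive x 1 F (f x) by apply: dF; rewrite !ltW.
  + by apply: cvg_at_right_filter; apply: cF; rewrite lexx ltW.
  + by apply: cvg_at_left_filter; apply: cF; rewrite lexx ltW.
move=> x; rewrite in_itv/= => /andP[ax xb]; rewrite derive1E.
have [_ ->] // : is_derive x 1 F (f x) by apply: dF; rewrite !ltW.
Qed.

Definition arcsine_density (t : R) : R := (Num.sqrt (t * (1 - t)))^-1.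

Lemma arcsine_density_ge0 t : 0 <= arcsine_density t.
Proof. by rewrite invr_ge0 sqrtr_ge0. Qed.

Lemma is_derive_arcsine (t : R) : 0 < t < 1 ->
  is_derive t 1 (fun s => asin (2 * s - 1)) (arcsine_density t).
Proof.
move=> /andP[t0 t1].
have h : -1 < 2 * t - 1 < 1 by apply/andP; split; lra.
have d1 : is_derive t 1 (fun s : R => 2 * s - 1) 2.
  have := is_deriveB (is_deriveZ 2 (is_derive_id t 1))
    (is_derive_cst (1 : R) t (1 : R)).
  by rewrite subr0 /GRing.scale/= mulr1.
have := @is_derive1_comp R (@asin R) (fun s : R => 2 * s - 1) t _ _
  (is_derive1_asin h) d1.
rewrite /arcsine_density 
  (_ : 1 - (2 * t - 1) ^+ 2 = 2 ^+ 2 * (t * (1 - t))); last by ring.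
rewrite sqrtrM ?sqr_ge0// sqrtr_sqr ger0_norm// invfM mulrAC mulVf ?mul1r//.
Qed.

Lemma continuous_arcsine_density (t : R) : 0 < t < 1 ->
  {for t, continuous arcsine_density}.
Proof.
move=> /andP[t0 t1].
apply: continuousV.
  by rewrite gt_eqF// sqrtr_gt0 mulr_gt0// subr_gt0.
apply: continuous_cvg; first exact: sqrt_continuous.
by apply: cvgM; [exact: cvg_id|apply: cvgB; [exact: cvg_cst|exact: cvg_id]].
Qed.

Lemma integral_arcsine_density (a b : R) : 0 < a -> a < b -> b < 1 ->
  (\int[mu]_(t in `[a, b]) (arcsine_density t)%:E =
   (asin (2 * b - 1) - asin (2 * a - 1))%:E)%E.
Proof.
move=> a0 ab b1.
apply: (@integral_is_derive _ (fun s => asin (2 * s - 1))) => // t /andP[? ?].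
  by apply: is_derive_arcsine; apply/andP; split; lra.
by apply: continuous_arcsine_density; apply/andP; split; lra.
Qed.

Lemma measurable_arcsine_density :
  measurable_fun (`]0, 1[%classic : set R) arcsine_density.
Proof.
apply: open_continuous_measurable_fun => // t.
by rewrite inE/= in_itv/=; exact: continuous_arcsine_density.
Qed.

(** The upper bound in the Beta integral $B(1/2,1/2)=\pi$: the primitive
    $\arcsin(2t-1)$ varies by at most $\pi$ on each of the compact intervals
    exhausting ]0, 1[. *)
Lemma integral_arcsine_density_le :
  (\int[mu]_(t in `]0%R, 1%R[) (arcsine_density t)%:E <= (pi : R)%:E)%E.
Proof.
pose e n : R := (n.+3%:R)^-1.
have e0 n : 0 < e n by rewrite invr_gt0.
have e12 n : e n < 2^-1 by rewrite ltf_pV2 ?posrE// ltr_nat.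
pose F n : set R := `[e n, 1 - e n]%classic.
have mf i : measurable_fun (F i) (fun t => (arcsine_density t)%:E).
  apply/measurable_EFinP.
  apply: measurable_funS measurable_arcsine_density => //.
  move=> t; rewrite /F /= !in_itv/= => /andP[? ?]; have := e0 i => ?.
  by apply/andP; split; lra.
have ndF : nondecreasing_seq F.
  move=> m n mn; apply/subsetPset => t; rewrite /F /= !in_itv/= => /andP[? ?].
  have : e n <= e m by rewrite lef_pV2 ?posrE// ler_nat !ltnS.
  by move=> ?; apply/andP; split; lra.
have := @ge0_nondecreasing_set_cvg_integral _ (measurableTypeR R) _ F
  (fun t => (arcsine_density t)%:E)
  (mu : {measure set (measurableTypeR R) -> \bar R}) ndF
  (fun=> measurable_itv _) mf
  (fun i t _ => arcsine_density_ge0 t).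
rewrite (_ : \bigcup_i F i = `]0%R, 1%R[%classic); last first.
  apply/seteqP; split => [t [n _]|t]; rewrite /F /= !in_itv/= => /andP[? ?].
    by have := e0 n => ?; apply/andP; split; lra.
  have m0 : 0 < Num.min t (1 - t) by rewrite lt_min; apply/andP; split; lra.
  have [n nt] : exists n, e n < Num.min t (1 - t).
    have [n] := ltr_add_invr m0; rewrite add0r => nt; exists n.
    apply: le_lt_trans nt; rewrite lef_pV2 ?posrE// ler_nat !ltnS leqW// leqW.
  exists n => //=; rewrite in_itv/=; move: nt; rewrite lt_min => /andP[? ?].
  by apply/andP; split; lra.
move=> cvgI; rewrite -(cvg_lim _ cvgI)//.
apply: lime_le; first by apply/cvg_ex; eexists; exact: cvgI.
apply: nearW => n; have := e0 n; have := e12 n => ? ?.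
rewrite integral_arcsine_density ?lee_fin//; try lra.
have h (t : R) : 0 < t < 1 -> -1 <= 2 * t - 1 <= 1.
  by move=> /andP[? ?]; apply/andP; split; lra.
have h1 : asin (2 * (1 - e n) - 1) <= pi / 2.
  by apply/asin_lepi2/h/andP; split; lra.
have h2 : - (pi / 2) <= asin (2 * e n - 1).
  by apply/asin_geNpi2/h/andP; split; lra.
lra.
Qed.

(** The endpoints are chosen so that $\arcsin(2t-1)$ takes the values [-th] and
    [th] there. *)
Lemma integral_arcsine_density_sin (th : R) : 0 < th < pi / 2 ->
  (\int[mu]_(t in `[((1 - sin th) / 2)%R, ((1 + sin th) / 2)%R])
     (arcsine_density t)%:E = (2 * th)%:E)%E.
Proof.
move=> /andP[th0 th2].
have s0 : 0 < sin th by rewrite sin_gt0_pi// th0/=; have := pi_gt0 R; lra.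
have s1 : sin th < 1.
  rewrite -sin_pihalf ltr_sin ?in_itv//=; apply/andP; split; lra.
rewrite integral_arcsine_density; [|lra..].
rewrite (_ : 2 * ((1 + sin th) / 2) - 1 = sin th); last by field.
rewrite (_ : 2 * ((1 - sin th) / 2) - 1 = sin (- th)); last first.
  by rewrite sinN; field.
by rewrite !sinK ?in_itv/=; [congr EFin; ring|apply/andP; split; lra..].
Qed.

End arcsine.

(** * Upper bounds for the Born-Jordan distribution *)

Section wigner_bound.
Context {R : realType}.
Notation mu := (@lebesgue_measure R).
Variable f : R -> R[i].
Hypothesis mf : cmeasurable f.

Let a (t : R) : R := Normc.normc (f t).

(** Uncurried integrand of [wigner]: the joint variable is (tau, y), which is
    what Tonelli's theorem needs. *)
Definition wigner_integrand (z : R * R) (p : R * R) : R[i] :=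
  cexpi (- (2 * pi * z.2 * p.2)) * f (z.1 + p.1 * p.2)
    * conjc (f (z.1 - (1 - p.1) * p.2)).

Lemma cmeasurable_wigner_integrand (z : R * R) :
  @cmeasurable R _ (measurableTypeR R * measurableTypeR R)%type
    (wigner_integrand z).
Proof.
apply: cmeasurableM; first apply: cmeasurableM.
- apply: (cmeasurable_comp (@cmeasurable_cexpi R)).
  by apply: measurableT_comp => //; apply: measurable_funM.
- apply: (cmeasurable_comp mf).
  by apply: measurable_funD => //; apply: measurable_funM.
- apply: cmeasurable_conj; apply: (cmeasurable_comp mf).
  by apply: measurable_funB => //; apply: measurable_funM => //;
    exact: measurable_funB.
Qed.

Lemma cmeasurable_wigner_section (z : R * R) (tau : R) :
  cmeasurable (fun y : R => wigner_integrand z (tau, y)).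
Proof.
have [rF jF] := cmeasurable_wigner_integrand z.
by split; [exact: (measurableT_comp rF)|exact: (measurableT_comp jF)].
Qed.

Lemma cmeasurable_wigner (z : R * R) :
  cmeasurable (fun tau : R => wigner tau f z).
Proof.
have [rF jF] := cmeasurable_wigner_integrand z.
by split; [exact: (measurable_Rintegral_section rF)|
  exact: (measurable_Rintegral_section jF)].
Qed.

Lemma normc_wigner_integrand (z : R * R) (tau y : R) :
  Normc.normc (wigner_integrand z (tau, y)) =
  a (z.1 + tau * y) * a (z.1 + - (1 - tau) * y).
Proof. by rewrite !Normc.normcM normc_cexpi normc_conj mul1r mulNr. Qed.

Let ma : measurable_fun setT a. Proof. exact: measurable_normc. Qed.
Let a0 t : 0 <= a t. Proof. exact: normc_ge0. Qed.

(** Taking absolute values removes the frequency [z.2]; what is left depends on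
    [z] only through the centre of the two dilations. *)
Lemma integral_normc_wigner_integrand (z : R * R) (tau : R) : 0 < tau < 1 ->
  (\int[mu]_y (Normc.normc (wigner_integrand z (tau, y)))%:E =
   (arcsine_density tau)%:E * corr a a z.1 tau z.1 (- (1 - tau)))%E.
Proof.
move=> /andP[t0 t1]; rewrite /corr -ge0_integralZl//; last 3 first.
- by apply/measurable_EFinP; exact: measurable_corr_integrand.
- by move=> y _; rewrite lee_fin !mulr_ge0 ?sqrtr_ge0.
- by rewrite lee_fin arcsine_density_ge0.
apply: eq_integral => y _; rewrite normc_wigner_integrand -EFinM; congr EFin.
have t1' : 0 < 1 - tau by rewrite subr_gt0.
rewrite normrN !gtr0_norm// /arcsine_density sqrtrM ?ltW//.
rewrite (mulrACA (Num.sqrt tau)) [RHS]mulrA.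
by rewrite mulVf ?mul1r// mulf_neq0// gt_eqF// sqrtr_gt0.
Qed.

Lemma normc_wigner_le (z : R * R) (tau : R) : 0 < tau < 1 ->
  ((Normc.normc (wigner tau f z))%:E <=
   (arcsine_density tau)%:E * corr a a z.1 tau z.1 (- (1 - tau)))%E.
Proof.
move=> t01; rewrite -integral_normc_wigner_integrand//.
by apply: normc_cintegral_le => //; exact: cmeasurable_wigner_section.
Qed.

Variable M : R.
Hypothesis aM : sqint a = M%:E.

Lemma corr_wigner_le (x tau : R) : 0 < tau < 1 ->
  (corr a a x tau x (- (1 - tau)) <= M%:E)%E.
Proof.
move=> /andP[t0 t1].
apply: (le_trans (@corr_le _ a a x tau x (- (1 - tau)) 1 _ _ _ _ _ _ _)) => //.
- by rewrite gt_eqF.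
- by rewrite oppr_eq0 subr_eq0 gt_eqF.
by rewrite aM -!EFinM -EFinD lee_fin; lra.
Qed.

Lemma normc_wigner_le_density (z : R * R) (tau : R) : 0 < tau < 1 ->
  ((Normc.normc (wigner tau f z))%:E <= (arcsine_density tau * M)%:E)%E.
Proof.
move=> t01; apply: (le_trans (normc_wigner_le _ t01)).
by rewrite EFinM lee_wpmul2l ?lee_fin ?arcsine_density_ge0// corr_wigner_le.
Qed.

Lemma arcsine_density_ge1 (t : R) : 0 < t < 1 -> 1 <= arcsine_density t.
Proof.
move=> /andP[t0 t1]; rewrite -[leLHS]invr1 lef_pV2 ?posrE//; last first.
  by rewrite sqrtr_gt0 mulr_gt0// subr_gt0.
by rewrite -[leRHS]sqrtr1 ler_wsqrtr//; nra.
Qed.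

(** If half of the bound is lost on ]0, t0[, where the density is at least 1,
    then the integral over ]0, 1[ loses at least [M / 2 * t0]. The gain is kept
    on the left-hand side as an indicator function, so that no subtraction of
    integrals occurs. *)
Lemma integral_normc_wigner_le (z : R * R) (t0 : R) : 0 < M -> 0 < t0 <= 1 ->
  (forall tau, 0 < tau < t0 ->
    (corr a a z.1 tau z.1 (- (1 - tau)) <= (M / 2)%:E)%E) ->
  (\int[mu]_(tau in `]0%R, 1%R[) (Normc.normc (wigner tau f z))%:E <=
   (pi * M - M / 2 * t0)%:E)%E.
Proof.
move=> M0 /andP[t00 t01] small.
have mW : measurable_fun (`]0, 1[%classic : set R)
    (fun tau : R => (Normc.normc (wigner tau f z))%:E).
  apply/measurable_EFinP/measurable_funTS/measurable_normc.
  exact: cmeasurable_wigner.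
pose h (tau : R) : \bar R := (M / 2 * \1_(`]0, t0[%classic : set R) tau)%:E.
have mh : measurable_fun (`]0, 1[%classic : set R) h.
  by apply/measurable_EFinP/measurable_funTS/measurable_funM.
have h0 t : (0 <= h t)%E by rewrite lee_fin mulr_ge0// divr_ge0// ltW.
have hint : (\int[mu]_(tau in `]0%R, 1%R[) h tau = (M / 2 * t0)%:E)%E.
  rewrite /h; under eq_integral do rewrite EFinM.
  rewrite ge0_integralZl//; last 2 first.
  - by apply/measurable_EFinP/measurable_funTS; exact: measurable_indic.
  - by rewrite lee_fin divr_ge0// ltW.
  rewrite integral_indic// setIidl; last first.
    move=> t; rewrite /= !in_itv/= => /andP[-> /=] /lt_le_trans; exact.
  by rewrite /= lebesgue_measure_itv/= lte_fin t00 oppr0 adde0 -EFinM.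
have pt : (\int[mu]_(tau in `]0%R, 1%R[)
    ((Normc.normc (wigner tau f z))%:E + h tau) <= (pi * M)%:E)%E.
  apply: (@le_trans _ _ (\int[mu]_(tau in `]0%R, 1%R[)
      (M%:E * (arcsine_density tau)%:E))%E).
    apply: ge0_le_integral => //.
    - by move=> t _; rewrite adde_ge0// lee_fin normc_ge0.
    - exact: emeasurable_funD.
    - apply: measurable_funeM; apply/measurable_EFinP.
      exact: measurable_arcsine_density.
    move=> t Dt; have t01' : 0 < t < 1 by move: Dt; rewrite /= in_itv.
    have d1 := arcsine_density_ge1 t01'.
    rewrite /h -EFinM -EFinD lee_fin indicE mem_setE.
    rewrite (_ : (t \in `]0, t0[) = (0 < t < t0)) ?in_itv//.
    have [tt0|tt0] := boolP (0 < t < t0).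
      have : Normc.normc (wigner t f z) <= arcsine_density t * (M / 2).
        rewrite -lee_fin EFinM; apply: (le_trans (normc_wigner_le _ t01')).
        by rewrite lee_wpmul2l ?lee_fin ?arcsine_density_ge0// small.
      have : 0 <= (arcsine_density t - 1) * (M / 2).
        by rewrite mulr_ge0 ?subr_ge0// divr_ge0// ltW.
      by rewrite mulr1; lra.
    rewrite mulr0 addr0 mulrC -lee_fin; exact: normc_wigner_le_density.
  rewrite ge0_integralZl//; last 3 first.
  - by apply/measurable_EFinP; exact: measurable_arcsine_density.
  - by move=> t _; rewrite lee_fin arcsine_density_ge0.
  - by rewrite lee_fin ltW.
  rewrite mulrC EFinM lee_wpmul2l//; last exact: integral_arcsine_density_le.
  by rewrite lee_fin ltW.
move: pt; rewrite ge0_integralD//; last first.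
  by move=> t _; rewrite lee_fin normc_ge0.
by rewrite hint -leeBrDr// -EFinB.
Qed.

(** The strict inequality, with a gap that does not depend on the phase-space
    point: every $\tau$-Wigner distribution is at most
    $(\tau(1-\tau))^{-1/2}\|f\|^2$, these bounds integrate to $\pi\|f\|^2$, and
    by decorrelation half of the bound is lost for all small $\tau$. *)
Lemma integral_normc_wigner_gap : 0 < M -> exists2 c, 0 < c & forall z,
  (\int[mu]_(tau in `]0%R, 1%R[) (Normc.normc (wigner tau f z))%:E <=
   (pi * M - c)%:E)%E.
Proof.
move=> M0; have [t0 /andP[t00 t0h] small] := corr_small_dilation ma a0 aM M0.
exists (M / 2 * t0); first by rewrite mulr_gt0// divr_gt0.
move=> z; apply: integral_normc_wigner_le => //.
  by apply/andP; split; lra.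
move=> tau /andP[tau0 taut]; apply: small => //.
by rewrite normrN gtr0_norm; [apply/andP; split; lra|lra].
Qed.

Lemma born_jordan_gap : 0 < M -> exists2 c, 0 < c &
  forall z, Normc.normc (born_jordan f z) <= pi * M - c.
Proof.
move=> M0; have [c c0 gap] := integral_normc_wigner_gap M0.
exists c => // z; rewrite -lee_fin; apply: le_trans (gap z).
by apply: normc_cintegral_le => //; exact: cmeasurable_wigner.
Qed.

Lemma wigner_integrable (z : R * R) (tau : R) : 0 < tau < 1 ->
  mu.-integrable setT
    (fun y => (complex.Re (wigner_integrand z (tau, y)))%:E).
Proof.
move=> t01; have [] // := cintegrable measurableT
  (cmeasurable_wigner_section z tau) (nu := mu).
rewrite integral_normc_wigner_integrand//.
apply: (@le_lt_trans _ _ ((arcsine_density tau)%:E * M%:E)%E).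
  by rewrite lee_wpmul2l ?lee_fin ?arcsine_density_ge0// corr_wigner_le.
by rewrite -EFinM ltry.
Qed.

Lemma born_jordan_integrable (z : R * R) : 0 < M ->
  mu.-integrable `]0, 1[%classic
    (fun tau : R => (complex.Re (wigner tau f z))%:E).
Proof.
move=> M0; have [c c0 gap] := integral_normc_wigner_gap M0.
have [] // := cintegrable (nu := mu) (D := `]0, 1[%classic) _
  (cmeasurable_wigner z).
by apply: le_lt_trans (gap z) _; rewrite ltry.
Qed.

End wigner_bound.

(** * Norms and boxes in phase space *)

Section norms.
Context {R : realType}.
Notation mu := (@lebesgue_measure R).

Lemma cLnorm2_sqr (f : R -> R[i]) :
  ((cLnorm mu 2%:E f) ^+ 2 = sqint (fun t => Normc.normc (f t)))%E.
Proof.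
have expe2E (x : \bar R) : (0 <= x -> x ^+ 2 = x `^ 2)%E.
  case: x => [x|_|//]; last by rewrite expe2 mulyy /= pnatr_eq0.
  by rewrite lee_fin => x0; rewrite -EFin_expe poweR_EFin powR_mulrn.
rewrite /cLnorm expe2E ?Lnorm_ge0// poweR_Lnorm//.
apply: eq_integral => t _ /=.
by rewrite (ger0_norm (normc_ge0 _)) powR_mulrn// normc_ge0.
Qed.

Lemma L2_sqint (f : R -> R[i]) : L2_nonzero f ->
  exists2 M, 0 < M & sqint (fun t => Normc.normc (f t)) = M%:E.
Proof.
move=> [[rf jf foo] fn0].
have s0 : (0 <= sqint (fun t => Normc.normc (f t)))%E.
  by apply: integral_ge0 => t _; rewrite lee_fin sqr_ge0.
have sfin : sqint (fun t => Normc.normc (f t)) \is a fin_num.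
  rewrite -cLnorm2_sqr fin_numX//.
  by rewrite ge0_fin_numE// /cLnorm Lnorm_ge0.
exists (fine (sqint (fun t => Normc.normc (f t)))); last by rewrite fineK.
rewrite fine_gt0// -ge0_fin_numE// sfin andbT lt0e s0 andbT.
apply: contra_notN fn0 => /eqP sE0.
have mN : measurable_fun setT (fun t => Normc.normc (f t)).
  by apply: measurable_normc; split.
have m2 : measurable_fun setT (fun t => (Normc.normc (f t) ^+ 2)%:E).
  by apply/measurable_EFinP; exact: measurable_funX.
have [+ _] := ae_eq_integral_abs mu measurableT m2.
under eq_integral do rewrite gee0_abs ?lee_fin ?sqr_ge0//.
move=> /(_ sE0); apply: filterS => t /(_ I) [] /eqP.
by rewrite expf_eq0/= => /eqP /Normc.eq0_normc ->.
Qed.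

Lemma lebesgue2T_gt0 : (0 < (@lebesgue2 R) [set: R * R])%E.
Proof.
have muT : (0 < mu setT)%E.
  apply: (@lt_le_trans _ _ (mu `]0%R, 1%R[%classic)).
    by rewrite lebesgue_measure_itv/= lte_fin ltr01 oppr0 adde0 lte01.
  by apply: le_measure; rewrite ?inE.
rewrite -setXTT (_ : lebesgue2 _ = (mu setT * mu setT)%E) ?mule_gt0//.
exact: product_measure1E.
Qed.

Lemma Linfty_norm_on_le (Omega : set (R * R)) (F : R * R -> R[i]) (C : R) :
  0 <= C -> (forall z, Normc.normc (F z) <= C) ->
  (Linfty_norm_on Omega F <= C%:E)%E.
Proof.
move=> C0 FC; rewrite /Linfty_norm_on /cLnorm unlock lebesgue2T_gt0.
apply/ess_supP; apply: nearW => z /=; rewrite lee_fin (ger0_norm (normc_ge0 _)).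
by rewrite /patch; case: ifP => // _; rewrite Normc.normc0.
Qed.

(** If a smaller essential bound held, then [Omega `&` A] would lie in a null
    set. *)
Lemma Linfty_norm_on_ge (Omega A : set (R * R)) (F : R * R -> R[i]) (c : R) :
  (0 < lebesgue2_vol (Omega `&` A))%E ->
  (forall z, A z -> c <= Normc.normc (F z)) ->
  (c%:E <= Linfty_norm_on Omega F)%E.
Proof.
move=> OA Fc; rewrite /Linfty_norm_on /cLnorm unlock lebesgue2T_gt0.
rewrite leNgt; apply/negP => /ereal_inf_lt[y [N [mN N0 subN]] yc].
move: OA; rewrite /lebesgue2_vol ltNge => /negP; apply.
rewrite -N0 -(measurable_mu_extE lebesgue2)//; apply: le_mu_ext.
move=> z [Oz Az]; apply: subN => /=; rewrite /patch mem_set// => zy.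
have := le_lt_trans zy yc.
by rewrite lte_fin (ger0_norm (normc_ge0 _)) ltNge Fc.
Qed.

(** A substitute for density points: the plane is a countable union of boxes of
    the given size, so one of them meets [Omega] in a non-null set. *)
Lemma lebesgue2_vol_box (Omega : set (R * R)) (e : R) : 0 < e ->
  (0 < lebesgue2_vol Omega)%E -> exists z0 : R * R,
  (0 < lebesgue2_vol (Omega `&`
    [set z | `|z.1 - z0.1| <= 1 /\ `|z.2 - z0.2| <= e]%R))%E.
Proof.
move=> e0 O0; apply: contrapT => /forallNP H.
pose c (p : int * int) : R * R := (p.1%:~R, e * p.2%:~R).
pose B (n : nat) : set (R * R) := Omega `&`
  (if unpickle n is Some p then
    [set z | `|z.1 - (c p).1| <= 1 /\ `|z.2 - (c p).2| <= e]%R else set0).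
have B0 n : lebesgue2_vol (B n) = 0%E.
  rewrite /B; case: (unpickle n) => [p|]; last first.
    by rewrite setI0 /lebesgue2_vol mu_ext0.
  apply/le_anti/andP; split; first by rewrite leNgt; apply/negP; exact: H.
  exact: mu_ext_ge0.
move: O0; rewrite ltNge => /negP; apply.
have OB : Omega `<=` \bigcup_n B n.
  move=> z Oz; pose p : int * int := (Num.floor z.1, Num.floor (z.2 / e)).
  exists (pickle p) => //; rewrite /B pickleK; split => //=.
  have /andP[m1 m2] := floor_itv z.1; have /andP[k1 k2] := floor_itv (z.2 / e).
  move: m2 k1 k2; rewrite ler_pdivlMr// ltr_pdivrMr// !intrD => m2 k1 k2.
  split; rewrite ger0_norm; lra.
apply: (le_trans (le_mu_ext lebesgue2 OB)).
apply: (le_trans (mu_ext_sigma_subadditive _ _)); first exact: measure_ge0.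
by rewrite eseries0// => n _ _; exact: B0.
Qed.

End norms.

(** * Logarithmic integrals *)

Section hyperbola.
Context {R : realType}.
Notation mu := (@lebesgue_measure R).

Lemma ge0_integral_even (k : R -> \bar R) : measurable_fun setT k ->
  (forall t, 0 <= k t)%E -> (forall t, k (- t) = k t) ->
  (\int[mu]_t k t = \int[mu]_(t in `[0%R, +oo[) k t +
    \int[mu]_(t in `[0%R, +oo[) k t)%E.
Proof.
move=> mk k0 ek.
rewrite [X in (_ = X + _)%E]ge0_integration_by_substitution0//.
rewrite [X in (_ = X + _)%E](_ : _ =
  \int[mu]_(t in `]-oo, 0%R[) k t)%E; last first.
  under eq_integral do rewrite ek.
  by rewrite integral_itv_bndo_bndc//; exact: measurable_funTS.
rewrite -ge0_integral_setU//=.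
- by rewrite -setCitvl setUv.
- exact: measurable_funTS.
- by rewrite -setCitvl; apply/disj_set2P; rewrite setICr.
Qed.

Definition hyperbola (c B t : R) : R := if `|t| < B then (c + `|t|)^-1 else 0.

Lemma hyperbola_ge0 c B t : 0 <= c -> 0 <= hyperbola c B t.
Proof.
by move=> c0; rewrite /hyperbola; case: ifP => // _; rewrite invr_ge0 addr_ge0.
Qed.

Lemma measurable_hyperbola c B : 0 < c ->
  measurable_fun setT (hyperbola c B).
Proof.
move=> c0; apply: measurable_fun_ifT => //.
  exact: measurable_fun_ltr.
apply: continuous_measurable_fun => t.
apply: (@continuousV R R (fun t : R => c + `|t|)).
  by rewrite gt_eqF// ltr_pwDl.
by apply: cvgD; [exact: cvg_cst|exact: norm_continuous].
Qed.

(** Logarithmic growth in [B]: the same asymptotics for every [c] is what makes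
    bounded translations of the argument harmless for large [B]. *)
Lemma integral_hyperbola (c B : R) : 0 < c -> 0 < B ->
  (\int[mu]_t (hyperbola c B t)%:E = (2 * (ln (c + B) - ln c))%:E)%E.
Proof.
move=> c0 B0; rewrite ge0_integral_even//; first last.
- by move=> t; rewrite /hyperbola normrN.
- by move=> t; rewrite lee_fin hyperbola_ge0// ltW.
- by apply/measurable_EFinP; exact: measurable_hyperbola.
suff -> : (\int[mu]_(t in `[0%R, +oo[) (hyperbola c B t)%:E =
    (ln (c + B) - ln c)%:E)%E by rewrite -EFinD mulrDl mul1r.
transitivity (\int[mu]_(t in `[0%R, B[) ((c + t)^-1)%:E)%E.
  rewrite integral_mkcond [RHS]integral_mkcond.
  apply: eq_integral => t _; rewrite /patch !mem_setE !in_itv/= andbT.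
  have [t0|//] := leP 0 t; rewrite /hyperbola ger0_norm//=.
  by case: ifP.
have cD (x : R) : 0 <= x -> {for x, continuous (fun t : R => (c + t)^-1)}.
  move=> x0; apply: continuousV; first by rewrite gt_eqF// ltr_pwDl.
  by apply: cvgD; [exact: cvg_cst|exact: cvg_id].
rewrite integral_itv_bndo_bndc; last first.
  apply/measurable_EFinP.
  apply: (@measurable_funS _ _ _ _ `](- c), +oo[%classic) => //.
    by move=> t; rewrite /= !in_itv/= => /andP[t0 _]; lra.
  apply: open_continuous_measurable_fun => // t; rewrite inE/= in_itv/= andbT.
  move=> ct; apply: continuousV; first by rewrite gt_eqF//; lra.
  by apply: cvgD; [exact: cvg_cst|exact: cvg_id].
have dF (x : R) : 0 <= x <= B ->
    is_derive x 1 (fun t => ln (c + t)) ((c + x)^-1).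
  move=> /andP[x0 _].
  have d1 : is_derive x 1 (fun t : R => c + t) 1.
    have := is_deriveD (is_derive_cst (c : R) x (1 : R)) (is_derive_id x 1).
    by rewrite add0r.
  have cx : 0 < c + x by rewrite ltr_pwDl.
  have := @is_derive1_comp R (@ln R) (fun t => c + t) x _ _
    (is_derive1_ln cx) d1.
  by rewrite mulr1.
rewrite (@integral_is_derive _ _ _ _ _ B0 dF) ?addr0//.
by move=> x /andP[x0 _]; exact: cD.
Qed.

End hyperbola.

(** * The near-extremizers *)

Section test_function.
Context {R : realType}.
Notation mu := (@lebesgue_measure R).

(** The near-extremizer $(1+|t|)^{-1/2}$: homogeneous of degree -1/2 at large
    scales, which is the formal equality case of the upper bound, but bounded at
    the origin so that the pairing is stable under bounded translations. The
    translation and the modulation move its distribution to the point [z0]. *)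
Definition test_fun (B : R) (z0 : R * R) (t : R) : R[i] :=
  (cexpi (2 * pi * z0.2 * t) * (Num.sqrt (hyperbola 1 B (t - z0.1)))%:C)%C.

Lemma normc_test_fun B z0 t :
  Normc.normc (test_fun B z0 t) = Num.sqrt (hyperbola 1 B (t - z0.1)).
Proof.
rewrite /test_fun Normc.normcM normc_cexpi mul1r /=.
by rewrite expr0n addr0 sqrtr_sqr ger0_norm// sqrtr_ge0.
Qed.

Lemma measurable_sqrt_hyperbola B :
  measurable_fun setT (fun t : R => Num.sqrt (hyperbola 1 B t)).
Proof.
by apply: (measurableT_comp measurable_sqrt); exact: measurable_hyperbola.
Qed.

Lemma cmeasurable_test_fun B z0 : cmeasurable (test_fun B z0).
Proof.
apply: cmeasurableM.
  apply: (cmeasurable_comp (@cmeasurable_cexpi R)); exact: measurable_funM.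
split => //=; apply: (measurableT_comp (measurable_sqrt_hyperbola B)).
exact: measurable_funB.
Qed.

Lemma sqint_test_fun B z0 : 0 < B ->
  sqint (fun t => Normc.normc (test_fun B z0 t)) = (2 * ln (1 + B))%:E.
Proof.
move=> B0; transitivity (\int[mu]_t (hyperbola 1 B (- z0.1 + 1 * t))%:E)%E.
  apply: eq_integral => t _; rewrite normc_test_fun sqr_sqrtr ?hyperbola_ge0//.
  by rewrite mul1r addrC.
rewrite -[LHS]mul1e -[X in (X%:E * _)%E](@normr1 R).
rewrite -(@ge0_integral_affine _ _ _ (EFin \o hyperbola 1 B))//=.
- by rewrite integral_hyperbola// ln1 subr0.
- by apply/measurable_EFinP; exact: measurable_hyperbola.
- by move=> t; rewrite lee_fin hyperbola_ge0.
Qed.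

Lemma test_fun_L2 B z0 : 0 < B -> L2_nonzero (test_fun B z0).
Proof.
move=> B0; have [rf jf] := cmeasurable_test_fun B z0.
have E := sqint_test_fun z0 B0.
split.
  split => //; have := cLnorm2_sqr (test_fun B z0); rewrite E.
  have : (0 <= cLnorm mu 2%:E (test_fun B z0))%E by rewrite Lnorm_ge0.
  by case: (cLnorm _ _ _) => [r _ _|_|//]; rewrite ?ltry// expe2 mulyy.
move=> f0.
have mN := measurable_normc (cmeasurable_test_fun B z0).
have : sqint (fun t => Normc.normc (test_fun B z0 t)) = 0%E.
  rewrite /sqint (@ae_eq_integral _ _ _ mu setT (cst 0%E))//.
  - exact: integral0.
  - by apply/measurable_EFinP; exact: measurable_funX.
  - apply: filterS f0 => t /(_ I) ->.
    by rewrite Normc.normc0 expr0n.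
rewrite E => -[] /eqP; rewrite mulf_eq0 pnatr_eq0/= => /eqP.
by apply/eqP; rewrite gt_eqF// ln_gt0// ltrDl.
Qed.

(** Covariance: the phases combine to one that depends only on the frequency
    relative to [z0.2]. *)
Lemma wigner_integrand_test_fun B z0 z tau y :
  complex.Re (wigner_integrand (test_fun B z0) z (tau, y)) =
  cos (2 * pi * (z.2 - z0.2) * y) *
  (Num.sqrt (hyperbola 1 B (z.1 - z0.1 + tau * y)) *
   Num.sqrt (hyperbola 1 B (z.1 - z0.1 - (1 - tau) * y))).
Proof.
rewrite /wigner_integrand /test_fun/=.
set u := z.1 + _; set v := z.1 - (1 - tau) * y.
rewrite (_ : 2 * pi * (z.2 - z0.2) * y =
  - (- (2 * pi * z.2 * y) + 2 * pi * z0.2 * u - 2 * pi * z0.2 * v)); last first.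
  by rewrite /u /v; ring.
rewrite (_ : z.1 - z0.1 + tau * y = u - z0.1); last by rewrite /u; ring.
rewrite (_ : z.1 - z0.1 - (1 - tau) * y = v - z0.1); last by rewrite /v; ring.
by rewrite [in RHS]cosN !cosD sinD !(cosN, sinN); ring.
Qed.

Lemma sqrt_hyperbola_neq0 (B t : R) :
  Num.sqrt (hyperbola 1 B t) != 0 -> `|t| < B.
Proof. by rewrite /hyperbola; case: ifP => //; rewrite sqrtr0 eqxx. Qed.

Section near_centre.
Variables (B s d : R) (z0 z : R * R).
Hypothesis cosd : forall t, `|t| <= 4 * pi * d * B -> s <= cos t.
Hypotheses (z1 : `|z.1 - z0.1| <= 1) (z2 : `|z.2 - z0.2| <= d).

(** The two arguments differ by [y], so both lie in the support only if
    |y| < 2B, where the oscillating factor is at least [s]. *)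
Lemma wigner_integrand_test_fun_ge tau y :
  s * (Num.sqrt (hyperbola 1 B (z.1 - z0.1 + tau * y)) *
       Num.sqrt (hyperbola 1 B (z.1 - z0.1 - (1 - tau) * y))) <=
  complex.Re (wigner_integrand (test_fun B z0) z (tau, y)).
Proof.
rewrite wigner_integrand_test_fun; set p := Num.sqrt _; set q := Num.sqrt _.
have [->|p0] := eqVneq p 0; first by rewrite mul0r !mulr0.
have [->|q0] := eqVneq q 0; first by rewrite !mulr0.
rewrite ler_wpM2r ?mulr_ge0 ?sqrtr_ge0//; apply: cosd.
have := sqrt_hyperbola_neq0 p0; have := sqrt_hyperbola_neq0 q0.
rewrite !ltr_norml => /andP[? ?] /andP[? ?].
have y2 : `|y| <= 2 * B by rewrite ler_norml; apply/andP; split; lra.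
rewrite !normrM (ger0_norm (pi_ge0 R)) (ger0_norm (ler0n R 2)).
rewrite (_ : 4 * pi * d * B = 2 * pi * d * (2 * B)); last by ring.
by rewrite ler_pM ?mulr_ge0 ?pi_ge0// ler_wpM2l// mulr_ge0 ?pi_ge0.
Qed.

(** Both profiles are compared with a single hyperbola: when |p| <= 1 and
    k <= tau, one has 1 + |p + tau y| <= tau (2/k + |y|), and similarly with
    1 - tau. The cut-off B - 1 keeps both arguments in the support. *)
Lemma sqrt_hyperbola_pair_ge (k tau y : R) : 0 < k -> k <= tau <= 1 - k ->
  arcsine_density tau * hyperbola (2 / k) (B - 1) y <=
  Num.sqrt (hyperbola 1 B (z.1 - z0.1 + tau * y)) *
  Num.sqrt (hyperbola 1 B (z.1 - z0.1 - (1 - tau) * y)).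
Proof.
move=> k0 /andP[kt tk].
have t0 : 0 < tau by lra.
have t1 : 0 < 1 - tau by lra.
rewrite {1}/hyperbola; case: ifPn => yB; last first.
  by rewrite mulr0 mulr_ge0 ?sqrtr_ge0.
have c0 : 0 < 2 / k + `|y| by rewrite ltr_pwDl// divr_gt0.
have one w v : k <= w -> w <= 1 -> `|v| = w * `|y| ->
    (Num.sqrt w)^-1 * (Num.sqrt (2 / k + `|y|))^-1 <=
    Num.sqrt (hyperbola 1 B (z.1 - z0.1 + v)).
  move=> kw w1 vE; have w0 : 0 < w by lra.
  have nv : `|z.1 - z0.1 + v| <= 1 + w * `|y|.
    by rewrite (le_trans (ler_normD _ _))// vE lerD2r.
  have wy : w * `|y| <= `|y| by rewrite ler_piMl.
  rewrite /hyperbola ifT; last lra.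
  rewrite -invfM -(sqrtrM _ (ltW w0)) sqrtrV; last by rewrite addr_ge0.
  rewrite lef_pV2 ?posrE ?sqrtr_gt0 ?mulr_gt0//.
  rewrite ler_wsqrtr// mulrDr.
  have : 2 <= w * (2 / k) by rewrite mulrA ler_pdivlMr//; lra.
  by lra.
rewrite /arcsine_density (sqrtrM _ (ltW t0)) invfM.
rewrite -[X in _ * X](@sqr_sqrtr _ _^-1) ?invr_ge0; last exact: ltW.
rewrite (sqrtrV (ltW c0)) expr2 mulrACA; apply: ler_pM.
- by rewrite mulr_ge0// invr_ge0 sqrtr_ge0.
- by rewrite mulr_ge0// invr_ge0 sqrtr_ge0.
- by apply: one; [|lra|rewrite normrM gtr0_norm].
- by apply: one; [lra|lra|rewrite normrN normrM gtr0_norm].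
Qed.

End near_centre.

End test_function.

(** * Lower bound and conclusion *)

Section lower_bound.
Context {R : realType}.
Notation mu := (@lebesgue_measure R).

Section near_centre.
Variables (B s d : R) (z0 z : R * R).
Hypotheses (B1 : 1 < B) (s0 : 0 < s).
Hypothesis cosd : forall t, `|t| <= 4 * pi * d * B -> s <= cos t.
Hypotheses (z1 : `|z.1 - z0.1| <= 1) (z2 : `|z.2 - z0.2| <= d).

Let B0 : 0 < B. Proof. exact: lt_trans B1. Qed.
Let f := test_fun B z0.
Let mf : cmeasurable f. Proof. exact: cmeasurable_test_fun. Qed.

Lemma Re_wigner_test_funE (tau : R) : 0 < tau < 1 ->
  ((complex.Re (wigner tau f z))%:E =
   \int[mu]_y (complex.Re (wigner_integrand f z (tau, y)))%:E)%E.
Proof.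
move=> t01; rewrite /= /Rintegral fineK//.
apply: integrable_fin_num => //.
exact: (wigner_integrable mf (sqint_test_fun z0 B0)).
Qed.

Lemma Re_wigner_test_fun_ge0 (tau : R) : 0 < tau < 1 ->
  0 <= complex.Re (wigner tau f z).
Proof.
move=> t01; rewrite -lee_fin Re_wigner_test_funE//.
apply: integral_ge0 => y _; rewrite lee_fin.
apply: (le_trans _ (wigner_integrand_test_fun_ge cosd z2 tau y)).
by rewrite !mulr_ge0 ?sqrtr_ge0// ltW.
Qed.

Lemma Re_wigner_test_fun_ge (k tau : R) : 0 < k -> k <= tau <= 1 - k ->
  s * arcsine_density tau * (2 * (ln (2 / k + (B - 1)) - ln (2 / k))) <=
  complex.Re (wigner tau f z).
Proof.
move=> k0 ktk; have /andP[kt tk] := ktk.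
rewrite -lee_fin Re_wigner_test_funE; last by apply/andP; split; lra.
have B10 : 0 < B - 1 by rewrite subr_gt0.
have k20 : 0 < 2 / k by rewrite divr_gt0.
have sd0 : 0 <= s * arcsine_density tau.
  by rewrite mulr_ge0 ?arcsine_density_ge0// ltW.
rewrite EFinM -(integral_hyperbola k20 B10) -ge0_integralZl//; last 2 first.
- by apply/measurable_EFinP; exact: measurable_hyperbola.
- by move=> y _; rewrite lee_fin hyperbola_ge0// ltW.
apply: ge0_le_integral => //.
- by move=> y _; rewrite -EFinM lee_fin mulr_ge0// hyperbola_ge0// ltW.
- apply: measurable_funeM; apply/measurable_EFinP; exact: measurable_hyperbola.
- by apply/measurable_EFinP; have [] := cmeasurable_wigner_section mf z tau.
move=> y _; rewrite -EFinM lee_fin -mulrA.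
apply: (le_trans _ (wigner_integrand_test_fun_ge cosd z2 tau y)).
by apply: ler_wpM2l; [exact: ltW|exact: sqrt_hyperbola_pair_ge].
Qed.

Lemma born_jordan_test_fun_ge (th : R) : 0 < th < pi / 2 ->
  s * (2 * (ln (2 / ((1 - sin th) / 2) + (B - 1)) -
            ln (2 / ((1 - sin th) / 2)))) * (2 * th) <=
  Normc.normc (born_jordan f z).
Proof.
move=> th02; have /andP[th0 th2] := th02; set k := (1 - sin th) / 2.
have sth1 : sin th < 1.
  by rewrite -sin_pihalf ltr_sin ?in_itv//=; apply/andP; split; lra.
have sth0 : 0 < sin th by rewrite sin_gt0_pi// th0/=; have := pi_gt0 R; lra.
have k0 : 0 < k by rewrite divr_gt0// subr_gt0.
have k12 : k < 2^-1 by rewrite /k; lra.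
have kE : (1 + sin th) / 2 = 1 - k by rewrite /k; field.
set L := 2 * _.
have k20 : 0 < 2 / k by rewrite divr_gt0.
have L0 : 0 <= L.
  have B10 : 0 < B - 1 by rewrite subr_gt0.
  rewrite /L mulr_ge0// subr_ge0 ler_ln ?posrE//; last exact: addr_gt0.
  by rewrite lerDl ltW.
have Re_le : complex.Re (born_jordan f z) <= Normc.normc (born_jordan f z).
  by apply: le_trans (normc_Re (born_jordan f z)); exact: ler_norm.
apply: le_trans Re_le.
have M0 : 0 < 2 * ln (1 + B) by rewrite mulr_gt0// ln_gt0// ltrDl.
have bjE : ((complex.Re (born_jordan f z))%:E =
    \int[mu]_(tau in `]0%R, 1%R[) (complex.Re (wigner tau f z))%:E)%E.
  rewrite [complex.Re _]/= /Rintegral fineK//; apply: integrable_fin_num => //.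
  exact: (born_jordan_integrable mf (sqint_test_fun z0 B0) z M0).
have mW : measurable_fun setT (fun tau : R => (complex.Re (wigner tau f z))%:E).
  by apply/measurable_EFinP; have [] := cmeasurable_wigner mf z.
have sub01 : `[k, 1 - k]%classic `<=` (`]0, 1[%classic : set R).
  by move=> t; rewrite /= !in_itv/= => /andP[? ?]; apply/andP; split; lra.
have sL0 : 0 <= s * L by rewrite mulr_ge0// ltW.
rewrite -lee_fin bjE EFinM -(integral_arcsine_density_sin th02) kE -/k.
rewrite -ge0_integralZl//; last 2 first.
- apply/measurable_EFinP; exact: measurable_funS measurable_arcsine_density.
- by move=> t _; rewrite lee_fin arcsine_density_ge0.
apply: (@le_trans _ _ (\int[mu]_(tau in `[k, (1 - k)%R])
    (complex.Re (wigner tau f z))%:E)%E).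
  apply: ge0_le_integral => //.
  - by move=> t _; rewrite -EFinM lee_fin mulr_ge0// arcsine_density_ge0.
  - apply: measurable_funeM; apply/measurable_EFinP.
    exact: measurable_funS measurable_arcsine_density.
  - exact: measurable_funTS.
  move=> t kt; rewrite -EFinM lee_fin mulrAC.
  by apply: Re_wigner_test_fun_ge => //; move: kt; rewrite /= in_itv.
apply: ge0_subset_integral => //; first exact: measurable_funTS.
move=> t t01; rewrite lee_fin; apply: Re_wigner_test_fun_ge0.
by move: t01; rewrite /= in_itv.
Qed.

End near_centre.

(** Choice of parameters: an angle close to $\pi/2$ recovers the Beta
    integral, a large cut-off makes the logarithmic corrections negligible,
    and only then is the frequency window shrunk. *)
Lemma BJ_ratio_lower (Omega : set (R * R)) (s : R) :
  (0 < lebesgue2_vol Omega)%E -> 0 < s < 1 ->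
  exists2 f, L2_nonzero f & ((s ^+ 3 * pi)%:E <= BJ_ratio Omega f)%E.
Proof.
move=> O0 /andP[s0 s1]; have p0 := pi_gt0 R.
pose th : R := s * (pi / 2).
have th02 : 0 < th < pi / 2.
  by rewrite mulr_gt0 ?divr_gt0//= gtr_pMl ?divr_gt0.
have /andP[th0 th2] := th02.
pose k : R := (1 - sin th) / 2.
have sth1 : sin th < 1.
  by rewrite -sin_pihalf ltr_sin ?in_itv//=; apply/andP; split; lra.
have sth0 : 0 < sin th by rewrite sin_gt0_pi// th0/=; lra.
have k0 : 0 < k by rewrite divr_gt0// subr_gt0.
have k12 : k < 2^-1 by rewrite /k; lra.
have k4 : 4 < 2 / k by rewrite ltr_pdivlMr//; lra.
have lk0 : 0 < ln (2 / k) by rewrite ln_gt0//; lra.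
(* With l = ln (1 + B), this choice turns 1 - ln (2 / k) / l into s. *)
pose l := ln (2 / k) / (1 - s).
have s10 : 0 < 1 - s by rewrite subr_gt0.
have l0 : 0 < l by rewrite divr_gt0.
have lkl : ln (2 / k) <= l.
  by rewrite ler_pdivlMr// ler_piMr ?ltW//; lra.
pose B := expR l - 1.
have lnB : ln (1 + B) = l by rewrite /B addrCA subrr addr0 expRK.
have B1 : 1 < B.
  have : 2 / k <= expR l by rewrite -ler_ln ?posrE ?expR_gt0// ?expRK//; lra.
  by rewrite /B; lra.
have B0 : 0 < B by lra.
have as01 : -1 <= s <= 1 by apply/andP; split; lra.
have ac0 : 0 < acos s by apply: acos_gt0; apply/andP; split; lra.
pose d := acos s / (4 * pi * B).
have d0 : 0 < d by rewrite divr_gt0// !mulr_gt0.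
have cosd t : `|t| <= 4 * pi * d * B -> s <= cos t.
  rewrite (_ : 4 * pi * d * B = acos s); last first.
    rewrite (_ : 4 * pi * d * B = d * (4 * pi * B)); last by ring.
    by rewrite /d divfK// gt_eqF// !mulr_gt0.
  have acpi : acos s <= pi by exact: acos_lepi.
  move=> tac; rewrite -[leLHS]acosK ?in_itv//= -[leRHS]cos_norm leNgt.
  rewrite ltr_cos ?in_itv/= -?leNgt ?normr_ge0 ?(le_trans tac)//.
  by rewrite ltW.
(* The box is chosen last, since its height d depends on B. *)
have [z0 z0P] := lebesgue2_vol_box d0 O0.
exists (test_fun B z0); first exact: test_fun_L2.
have M0 : 0 < 2 * l by rewrite mulr_gt0.
rewrite /BJ_ratio cLnorm2_sqr sqint_test_fun// lnB inver gt_eqF//.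
have key z : `|z.1 - z0.1| <= 1 /\ `|z.2 - z0.2| <= d ->
    s ^+ 3 * pi * (2 * l) <= Normc.normc (born_jordan (test_fun B z0) z).
  move=> [z1 z2]; apply: le_trans
    (born_jordan_test_fun_ge B1 s0 cosd z1 z2 th02).
  rewrite -/k.
  have h : l * s <= ln (2 / k + (B - 1)) - ln (2 / k).
    have : l <= ln (2 / k + (B - 1)).
      by rewrite -lnB ler_ln ?posrE; lra.
    have : ln (2 / k) = l * (1 - s) by rewrite /l divfK// gt_eqF.
    by lra.
  rewrite (_ : s ^+ 3 * pi * (2 * l) =
    s * (2 * (l * s)) * (2 * th)); last first.
    by rewrite /th; field.
  by rewrite ler_wpM2r ?ler_wpM2l// ?mulr_ge0// ltW.
rewrite lee_pdivlMr// -?EFinM.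
exact: Linfty_norm_on_ge key.
Qed.

Lemma BJ_ratio_lt_pi (Omega : set (R * R)) (f : R -> R[i]) :
  L2_nonzero f -> (BJ_ratio Omega f < pi%:E)%E.
Proof.
move=> fL2; have [M M0 fM] := L2_sqint fL2.
have mf : cmeasurable f by have [[rf jf _] _] := fL2; split.
have [c c0 gap] := born_jordan_gap mf fM M0.
have C0 : 0 <= pi * M - c by apply: le_trans (gap (0, 0)); exact: normc_ge0.
have H := Linfty_norm_on_le Omega C0 gap.
rewrite /BJ_ratio cLnorm2_sqr fM inver gt_eqF// lte_pdivrMr//.
by apply: (le_lt_trans H); rewrite -EFinM lte_fin; lra.
Qed.

End lower_bound.

Unset Implicit Arguments.

Theorem proposition6p8 (R : realType) (Omega : set (R * R))
    (mOmega : lebesgue2_measurable Omega)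
    (Omega_gt0 : (0 < lebesgue2_vol Omega)%E)
    (Omega_fin : (lebesgue2_vol Omega < +oo)%E) :
  ereal_sup [set BJ_ratio Omega f | f in L2_nonzero] = pi%:E /\
  ~ (exists2 f, L2_nonzero f & BJ_ratio Omega f = pi%:E).
Proof.
split; last by move=> [f /(BJ_ratio_lt_pi Omega) + fE]; rewrite fE ltxx.
apply/le_anti/andP; split.
  by apply: ge_ereal_sup => _ [f fL2 <-]; apply/ltW; exact: BJ_ratio_lt_pi.
have p0 := pi_gt0 R.
have low (s : R) : 0 < s < 1 ->
    ((s ^+ 3 * pi)%:E <= ereal_sup [set BJ_ratio Omega f | f in L2_nonzero])%E.
  move=> s01; have [f fL2 sf] := BJ_ratio_lower Omega_gt0 s01.
  by apply: (le_trans sf); apply: ereal_sup_ubound; exists f.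
rewrite leNgt; apply/negP; move: low.
case: (ereal_sup _) => [r low|//|low _]; last first.
  by have := low 2^-1; rewrite leeNy_eq; apply/implyP; lra.
rewrite lte_fin => rpi.
have r0 : 0 < r.
  apply: (@lt_le_trans _ _ (2^-1 ^+ 3 * pi)).
    by rewrite mulr_gt0// exprn_gt0.
  by rewrite -lee_fin; apply: low; apply/andP; split; lra.
(* By Bernoulli's inequality (1 - u)^3 pi >= pi - 3 (pi - r) / 4 > r. *)
pose u := (pi - r) / (4 * pi).
have u0 : 0 < u by rewrite divr_gt0 ?subr_gt0// mulr_gt0.
have u1 : u < 1 by rewrite ltr_pdivrMr ?mulr_gt0//; lra.
have := low (1 - u); rewrite lee_fin.
have up : u * pi = (pi - r) / 4 by rewrite /u invfM mulrA divfK// gt_eqF.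
have u3 : 0 <= 3 - u by lra.
have : 0 <= u ^+ 2 * (3 - u) * pi.
  by apply: mulr_ge0; [apply: mulr_ge0 => //; exact: sqr_ge0|exact: ltW].
rewrite (_ : (1 - u) ^+ 3 * pi = pi - 3 * (u * pi) + u ^+ 2 * (3 - u) * pi).
  by rewrite up => ? h; have := h _; lra.
ring.
Qed.
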